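(* Let $\sigma_1,\dots,\sigma_k$ be non-crossing partitions and let $p$ be a permutation of $\{1,\dots,k\}$. Then $\sigma_1[\sigma_2]\cdots[\sigma_k]$ and $\sigma_{p(1)}[\sigma_{p(2)}]\cdots[\sigma_{p(k)}]$ are cc-equivalent.
   Context: Set partitions are written in canonical sequential form (restricted growth words). A partition is non-crossing if it avoids the pattern $1212$ (pattern containment = having a subsequence order-isomorphic to the pattern). For partitions $\alpha,\beta$, $\alpha[\beta]$ is the concatenation of $\alpha$ with $\beta+r$, $r$ the number of blocks of $\alpha$ (adding $r$ to every letter of $\beta$); this operation is associative. A partition is connected if it cannot be written as $\alpha[\beta]$ with $\alpha,\beta$ nonempty; the components of $\pi$ are the unique nonempty connected $\sigma_i$ with $\pi=\sigma_1[\sigma_2]\cdots[\sigma_m]$. Two non-crossing patterns $\sigma,\tau$ are cc-equivalent if there is a bijection from the set of partitions avoiding both $1212$ and $\sigma$ to the set of partitions avoiding both $1212$ and $\tau$ that preserves size and number of components. *)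

(* Defs.v *)
From mathcomp Require Import all_boot all_fingroup.
Set Implicit Arguments. Unset Strict Implicit. Unset Printing Implicit Defensive.

(* Set partitions in canonical sequential form: restricted growth words over
   the letters 1,2,3,...  The empty word is the empty partition. *)

Definition nblocks (s : seq nat) : nat := foldr maxn 0 s.

Fixpoint rgw_aux (m : nat) (s : seq nat) : bool :=
  match s with
  | [::] => true
  | x :: t => [&& 0 < x, x <= m.+1 & rgw_aux (maxn m x) t]
  end.
Definition is_partition (s : seq nat) : bool := rgw_aux 0 s.

Definition order_iso (x p : seq nat) : bool :=
  (size x == size p) &&
  all (fun i => all (fun j => (nth 0 x i < nth 0 x j) == (nth 0 p i < nth 0 p j))
                    (iota 0 (size p))) (iota 0 (size p)).

Definition contains (s p : seq nat) : Prop :=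
  exists m : bitseq, size m = size s /\ order_iso (mask m s) p.
Definition avoids (s p : seq nat) : Prop := ~ contains s p.

Definition pat1212 : seq nat := [:: 1; 2; 1; 2].

Definition noncrossing (s : seq nat) : Prop := is_partition s /\ avoids s pat1212.

Definition bracket (a b : seq nat) : seq nat := a ++ map (addn (nblocks a)) b.

(* iterated sigma_1[sigma_2]...[sigma_k] (associative, so the bracketing is irrelevant) *)
Definition bracket_all (ss : seq (seq nat)) : seq nat := foldr bracket [::] ss.

Definition connected (pi : seq nat) : Prop :=
  is_partition pi /\ pi <> [::] /\
  ~ (exists a b, [/\ is_partition a, is_partition b, a <> [::], b <> [::] &
                     pi = bracket a b]).

(* pi has exactly m components: pi = s_1[s_2]...[s_m] with the s_i nonempty connected
   (such a decomposition is unique) *)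
Definition has_ncomp (pi : seq nat) (m : nat) : Prop :=
  exists ss : seq (seq nat),
    [/\ size ss = m, (forall s, s \in ss -> connected s) & pi = bracket_all ss].

Definition Av (sigma pi : seq nat) : Prop :=
  [/\ is_partition pi, avoids pi pat1212 & avoids pi sigma].

Definition cc_equiv (sigma tau : seq nat) : Prop :=
  [/\ noncrossing sigma, noncrossing tau &
   exists f g : seq nat -> seq nat,
     (forall pi, Av sigma pi ->
        [/\ Av tau (f pi), g (f pi) = pi, size (f pi) = size pi &
            forall m, has_ncomp pi m <-> has_ncomp (f pi) m]) /\
     (forall rho, Av tau rho -> Av sigma (g rho) /\ f (g rho) = rho)].

(* Main.v *)
(* For noncrossing s, s contains a[b] iff for some d the prefix of s before the first letter
   d+1 contains a and the subword of letters above d contains b. These d form an interval, so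
   the indicator of "s contains a[b]" is the number of such d minus the number of consecutive
   pairs of them, and both numbers are values of convolutions over the cuts of s.
   A noncrossing word is recovered from its cut (u, w) and from the way the remaining letters,
   taken from u, are inserted between components of w; this data is a chain in a product of
   two intervals of lengths ncomp u and ncomp w, and the number of chains giving a fixed number
   of components is symmetric in the two lengths. Hence convolution is commutative up to
   equality of the joint distribution of size and number of components, so a[b] and b[a] are
   equidistributed, and bracketing respects equidistribution. *)

Require Import Defs.
From mathcomp Require Import all_boot all_fingroup.
From mathcomp Require Import zify.

Set Implicit Arguments.
Unset Strict Implicit.
Unset Printing Implicit Defensive.

(** * Generating noncrossing words letter by letter *)

(* The letters x of s with no smaller letter after their last occurrence: in a noncrossing
   word these are the letters that can be reused, one for each component. *)
Definition opens (s : seq nat) : seq nat :=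
  foldl (fun st x => rcons [seq y <- st | y < x] x) [::] s.
(** The letters that can extend a noncrossing word. Any other used letter x has a smaller letter
    after it which also occurs before the first x, so reusing x would create 1212. *)
Definition next (s : seq nat) : seq nat := rcons (opens s) (nblocks s).+1.
Definition ncomp (s : seq nat) : nat := size (opens s).

Fixpoint NC (n : nat) : seq (seq nat) :=
  if n is m.+1 then [seq rcons s x | s <- NC m, x <- next s] else [:: [::]].

Lemma opens_rcons s x :
  opens (rcons s x) = rcons [seq y <- opens s | y < x] x.
Proof. by rewrite /opens foldl_rcons. Qed.

Lemma nblocks_rcons s x : nblocks (rcons s x) = maxn (nblocks s) x.
Proof. by elim: s => [|y s IH] /=; rewrite ?maxn0 ?max0n // IH maxnA. Qed.

Lemma nblocks_ge s x : x \in s -> x <= nblocks s.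
Proof.
elim: s => //= y s IH; rewrite inE leq_max => /orP[/eqP->|/IH->]; first by rewrite leqnn.
by rewrite orbT.
Qed.

Lemma nblocks_cat s t : nblocks (s ++ t) = maxn (nblocks s) (nblocks t).
Proof. by elim: s => [|x s IH] /=; rewrite ?max0n // IH maxnA. Qed.

Lemma sorted_opens s : sorted ltn (opens s).
Proof.
elim/last_ind: s => // s x IH; rewrite opens_rcons.
have Hs := sorted_filter ltn_trans (fun y => y < x) IH.
case E: [seq y <- opens s | y < x] => [|a l] //=.
rewrite E /= in Hs; rewrite rcons_path Hs /=.
have: last a l \in [seq y <- opens s | y < x] by rewrite E mem_last.
by rewrite mem_filter => /andP[].
Qed.

Lemma opens_sub s : {subset opens s <= s}.
Proof.
elim/last_ind: s => // s x IH y; rewrite opens_rcons !mem_rcons !inE mem_filter.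
by case/orP => [->//|/andP[_ /IH ->]]; rewrite orbT.
Qed.

Lemma sorted_next s : sorted ltn (next s).
Proof.
rewrite /next; have := sorted_opens s.
case E: (opens s) => [|a l] //= H; rewrite rcons_path H /= ltnS.
by apply: nblocks_ge; apply: opens_sub; rewrite E mem_last.
Qed.

Lemma size_next s : size (next s) = (ncomp s).+1.
Proof. by rewrite size_rcons. Qed.

Lemma filter_sorted_nth l k : sorted ltn l -> k < size l ->
  [seq y <- l | y < nth 0 l k] = take k l.
Proof.
move=> Hl Hk; transitivity [seq y <- take k l ++ drop k l | y < nth 0 l k].
  by rewrite cat_take_drop.
rewrite filter_cat (drop_nth 0 Hk) /= ltnn.
rewrite (@eq_in_filter _ _ predT) ?filter_predT; last first.
  move=> y /(nthP 0)[i]; rewrite size_take Hk => Hi <-; rewrite nth_take //=.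
  by apply: (sorted_ltn_nth ltn_trans 0 Hl); rewrite ?inE //; apply: ltn_trans Hk.
rewrite (@eq_in_filter _ _ pred0) ?filter_pred0 ?cats0 // => y /(nthP 0)[i].
rewrite size_drop => Hi <-; rewrite nth_drop /=; apply/negbTE; rewrite -leqNgt ltnW //.
have {}Hi : i < size l - k.+1 := Hi.
by apply: (sorted_ltn_nth ltn_trans 0 Hl); rewrite ?inE //; lia.
Qed.

Lemma opens_rcons_next s k : k <= ncomp s ->
  opens (rcons s (nth 0 (next s) k)) = take k.+1 (next s).
Proof.
move=> Hk; have Hk' : k < size (next s) by rewrite size_next.
rewrite opens_rcons (take_nth 0) // -(filter_sorted_nth (sorted_next s)) //; congr rcons.
rewrite {3}/next filter_rcons ifF //; apply/negbTE; rewrite -leqNgt.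
have : nth 0 (next s) k \in next s by apply: mem_nth.
rewrite {2}/next mem_rcons inE => /orP[/eqP->//|/opens_sub/nblocks_ge]; lia.
Qed.

(** This is the Catalan generating tree: a word with c components has exactly one child with each of
    1, ..., c + 1 components. *)
Lemma ncomp_rcons_next s k : k <= ncomp s ->
  ncomp (rcons s (nth 0 (next s) k)) = k.+1.
Proof. by move=> Hk; rewrite /ncomp opens_rcons_next // size_takel // size_next. Qed.

Lemma NC_ind (P : seq nat -> Prop) : P [::] ->
  (forall n s x, s \in NC n -> P s -> x \in next s -> P (rcons s x)) ->
  forall n s, s \in NC n -> P s.
Proof.
move=> P0 PS; elim=> [|n IH] s /=; first by rewrite inE => /eqP->.
by case/allpairsPdep => s' [x [Hs' Hx ->]]; apply: (PS n) => //; apply: IH.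
Qed.

Lemma mem_NC_rcons n s x :
  (rcons s x \in NC n.+1) = (s \in NC n) && (x \in next s).
Proof.
apply/allpairsPdep/andP => [[s' [x' [Hs Hx /rcons_inj[-> ->]]]]|[Hs Hx]] //.
by exists s, x.
Qed.

Lemma size_NC n s : s \in NC n -> size s = n.
Proof.
elim: n s => [|n IH] s; first by rewrite inE => /eqP->.
case/lastP: s => [|s x]; last by rewrite mem_NC_rcons size_rcons => /andP[/IH->].
by case/allpairsPdep => s' [x' [_ _]] /(congr1 size); rewrite size_rcons.
Qed.

Lemma uniq_next s : uniq (next s).
Proof. apply: (sorted_uniq ltn_trans ltnn); apply: sorted_next. Qed.

Lemma uniq_NC n : uniq (NC n).
Proof.
elim: n => //= n IH; apply: allpairs_uniq_dep => //.
  by move=> s _; apply: uniq_next.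
by move=> [s x] [s' x'] _ _ /= /rcons_inj[-> ->].
Qed.

Arguments NC : simpl never.

Lemma mem_NC_letter n s : s \in NC n -> forall x, (x \in s) = (0 < x <= nblocks s).
Proof.
move: n s; apply: NC_ind => [|n s y Hs IH Hy] x; first by rewrite in_nil; case: x.
rewrite mem_rcons inE IH nblocks_rcons.
move: Hy; rewrite mem_rcons inE => /orP[/eqP->|/opens_sub]; first by lia.
by rewrite IH; lia.
Qed.

(** * Cutting a word at a block *)

(* The cut of s at d: [pre d s] stops before the first letter d+1 and [suf d s] keeps the
   letters above d; the letters <= d after the cut occur in neither.
   If d+1 is not a letter of s, then [pre d s] is s. *)
Definition pre (d : nat) (s : seq nat) : seq nat := take (index d.+1 s) s.
Definition suf (d : nat) (s : seq nat) : seq nat := [seq x - d | x <- s & d < x].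

Lemma pre_rcons d s x : d.+1 \in s -> pre d (rcons s x) = pre d s.
Proof.
move=> H; rewrite /pre -cats1 index_cat H take_cat index_mem H //.
Qed.

Lemma pre_notin d s : d.+1 \notin s -> pre d s = s.
Proof. by move=> H; rewrite /pre memNindex // take_size. Qed.

Lemma suf_rcons d s x :
  suf d (rcons s x) = if d < x then rcons (suf d s) (x - d) else suf d s.
Proof. by rewrite /suf filter_rcons; case: ifP => // _; rewrite map_rcons. Qed.

Lemma nblocks_suf d s : nblocks (suf d s) = nblocks s - d.
Proof.
elim/last_ind: s => // s x IH; rewrite suf_rcons nblocks_rcons.
by case: ifP; rewrite ?nblocks_rcons IH; lia.
Qed.

Lemma NC_cat n s t : s ++ t \in NC n -> s \in NC (size s).
Proof.
elim/last_ind: t n => [|t x IH] n; first by rewrite cats0 => /[dup]/size_NC->.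
rewrite -rcons_cat; case: n => [|n]; first by move/size_NC; rewrite size_rcons.
by rewrite mem_NC_rcons => /andP[/IH].
Qed.

Lemma pre_NC n s d : s \in NC n -> pre d s \in NC (size (pre d s)).
Proof. by rewrite -{1}(cat_take_drop (index d.+1 s) s); apply: NC_cat. Qed.

Lemma nblocks_pre n s d : s \in NC n -> d <= nblocks s -> nblocks (pre d s) = d.
Proof.
move: n s; apply: NC_ind => [|n s x Hs IH Hx]; first by case: d.
have Hm := mem_NC_letter Hs.
rewrite nblocks_rcons => Hd; have [Hd'|Hd'] := ltnP d (nblocks s).
  by rewrite pre_rcons ?IH // ?Hm; lia.
have Hx' : 0 < x <= (nblocks s).+1.
  move: Hx; rewrite mem_rcons inE => /orP[/eqP->|/opens_sub]; rewrite ?Hm; lia.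
case: (eqVneq x d.+1) => [Ex|Nx].
  rewrite /pre -cats1 index_cat ifF ?Hm; last by lia.
  rewrite /= Ex eqxx addn0 take_size_cat //; lia.
rewrite pre_notin ?nblocks_rcons; last by rewrite mem_rcons inE Hm; lia.
lia.
Qed.

(** A letter [<= d] closes all letters above d at once but leaves no trace in [suf d s]. The letters
    [l], open in the right factor only, last occurred before such a letter, hence before the
    others. *)
Lemma opens_suf n s d : s \in NC n ->
  exists l, opens (suf d s) = l ++ [seq y - d | y <- opens s & d < y].
Proof.
move: n s; apply: NC_ind => [|n s x Hs [l IH] Hx]; first by exists [::].
rewrite suf_rcons opens_rcons filter_rcons; case: ifP => Hd; last first.
  exists (opens (suf d s)); rewrite -filter_predI (@eq_in_filter _ _ pred0) ?filter_pred0 ?cats0 //.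
  by move=> y _ /=; lia.
exists [seq y <- l | y < x - d]; rewrite opens_rcons map_rcons -rcons_cat IH filter_cat.
congr (rcons (_ ++ _) _).
rewrite filter_map -!filter_predI; congr map; apply: eq_filter => y /=.
by lia.
Qed.

Lemma suf_NC n s d : s \in NC n -> suf d s \in NC (size (suf d s)).
Proof.
move: n s; apply: NC_ind => // n s x Hs IH Hx.
rewrite suf_rcons; case: ifP => // Hd; rewrite size_rcons mem_NC_rcons IH /=.
move: Hx; rewrite !mem_rcons !inE nblocks_suf => /orP[/eqP Ex|Hx].
  by apply/orP; left; apply/eqP; lia.
apply/orP; right; have [l ->] := opens_suf d Hs.
by rewrite mem_cat (map_f (subn^~ d)) ?orbT // mem_filter Hd.
Qed.

(** Open letters of s in the left and in the right factor: they mark the components of the two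
    factors that are still accessible. *)
Definition lo (d : nat) (s : seq nat) := [seq y <- opens s | y <= d].
Definition hi (d : nat) (s : seq nat) := [seq y <- opens s | d < y].

Lemma sorted_cat_filter d l : sorted ltn l ->
  l = [seq y <- l | y <= d] ++ [seq y <- l | d < y].
Proof.
elim: l => //= a l IH Hp; have Hl := path_sorted Hp.
have [Ha|Ha] := leqP a d; first by rewrite /= -IH.
rewrite (@eq_in_filter _ _ pred0) ?filter_pred0 /=; last first.
  by move=> y Hy /=; have := allP (order_path_min ltn_trans Hp) _ Hy => /=; lia.
rewrite (@eq_in_filter _ _ predT) ?filter_predT //.
by move=> y Hy /=; have := allP (order_path_min ltn_trans Hp) _ Hy => /=; lia.
Qed.

Lemma opens_lo_hi d s : opens s = lo d s ++ hi d s.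
Proof. exact: (sorted_cat_filter d (sorted_opens s)). Qed.

Lemma ncomp_lo_hi d s : ncomp s = size (lo d s) + size (hi d s).
Proof. by rewrite /ncomp (opens_lo_hi d) size_cat. Qed.

Lemma next_suf n s d : s \in NC n -> d <= nblocks s ->
  exists2 l, size l + size (hi d s) = ncomp (suf d s)
    & next (suf d s) = l ++ [seq y - d | y <- rcons (hi d s) (nblocks s).+1].
Proof.
move=> Hs Hd; have [l Hl] := opens_suf d Hs; exists l.
  by rewrite /ncomp Hl size_cat size_map.
by rewrite /next Hl nblocks_suf map_rcons -rcons_cat subSn.
Qed.

Lemma lo_rcons d s x : lo d (rcons s x) =
  if x <= d then rcons [seq y <- opens s | y < x] x else lo d s.
Proof.
rewrite /lo opens_rcons filter_rcons -filter_predI; case: ifP => Hx.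
  by congr rcons; apply: eq_filter => y /=; lia.
by apply: eq_filter => y /=; lia.
Qed.

Lemma hi_rcons d s x : hi d (rcons s x) =
  if d < x then rcons [seq y <- hi d s | y < x] x else [::].
Proof.
rewrite /hi opens_rcons filter_rcons -!filter_predI; case: ifP => Hx.
  by congr rcons; apply: eq_filter => y /=; lia.
by rewrite (@eq_filter _ _ pred0) ?filter_pred0 // => y /=; lia.
Qed.

Lemma size_lo_rcons_lo d s k : k < size (lo d s) ->
  size (lo d (rcons s (nth 0 (lo d s) k))) = k.+1.
Proof.
move=> Hk; rewrite lo_rcons.
have -> : nth 0 (lo d s) k <= d.
  by have := mem_nth 0 Hk; rewrite {2}/lo mem_filter => /andP[].
have -> : nth 0 (lo d s) k = nth 0 (opens s) k by rewrite (opens_lo_hi d) nth_cat Hk.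
rewrite filter_sorted_nth ?sorted_opens // ?size_rcons ?size_takel //.
  by rewrite (opens_lo_hi d) size_cat; lia.
by rewrite (opens_lo_hi d) size_cat; lia.
Qed.

Lemma sorted_hi_next d s : sorted ltn (rcons (hi d s) (nblocks s).+1).
Proof.
have -> : rcons (hi d s) (nblocks s).+1 = drop (size (lo d s)) (next s).
  by rewrite /next (opens_lo_hi d) rcons_cat drop_size_cat.
by apply: drop_sorted; apply: sorted_next.
Qed.

Lemma size_hi_rcons_hi d s k : d <= nblocks s -> k <= size (hi d s) ->
  let x := nth 0 (rcons (hi d s) (nblocks s).+1) k in
  d < x /\ size (hi d (rcons s x)) = k.+1.
Proof.
move=> Hd Hk; set L := rcons _ _ => x.
have HkL : k < size L by rewrite size_rcons.
have Hx : d < x.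
  have : x \in L by apply: mem_nth.
  rewrite mem_rcons inE mem_filter => /orP[/eqP->|/andP[->]]; lia.
split=> //; rewrite hi_rcons Hx size_rcons; congr _.+1.
have -> : [seq y <- hi d s | y < x] = [seq y <- L | y < x].
  rewrite /L filter_rcons ifF //; apply/negbTE; rewrite -leqNgt.
  have : x \in L by apply: mem_nth.
  rewrite mem_rcons inE mem_filter => /orP[/eqP->//|/andP[_ /opens_sub/nblocks_ge]]; lia.
by rewrite filter_sorted_nth ?sorted_hi_next // size_takel // ltnW.
Qed.

(** * Recursion for sums over cuts *)

(* With i = #|lo| and e = #|hi|, appending a letter x of next s either closes part of
   the left factor (x <= d) or appends a letter to the right factor w (d < x), whose
   accessible blocks are then its last e blocks and the new one. *)
Definition dstep (F : seq nat -> seq nat -> nat -> nat -> nat) (u w : seq nat) (i e : nat) :=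
  \sum_(k < i) F u w k.+1 0 +
  \sum_(k < e.+1) F u (rcons w (nth 0 (next w) (ncomp w - e + k))) i k.+1.

Definition cutF (F : seq nat -> seq nat -> nat -> nat -> nat) (d : nat) (s : seq nat) :=
  F (pre d s) (suf d s) (size (lo d s)) (size (hi d s)).

(** Since [d < nblocks s], the cut already lies inside s and a new letter leaves [pre d s] alone;
    only the right factor and the two accessible counts change. *)
Lemma cut_step F n s d : s \in NC n -> d < nblocks s ->
  \sum_(x <- next s) cutF F d (rcons s x) = cutF (dstep F) d s.
Proof.
move=> Hs Hd; have Hm := mem_NC_letter Hs.
rewrite /next (opens_lo_hi d) rcons_cat big_cat /= /cutF /dstep.
have Hpre x : pre d (rcons s x) = pre d s by apply: pre_rcons; rewrite Hm; lia.
congr (_ + _).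
  rewrite (big_nth 0) big_mkord; apply: eq_bigr => k _.
  rewrite Hpre size_lo_rcons_lo //.
  have Hk : nth 0 (lo d s) k <= d.
    by have := mem_nth 0 (ltn_ord k); rewrite {2}/lo mem_filter => /andP[].
  by rewrite hi_rcons suf_rcons !ifF //; apply/negbTE; rewrite -leqNgt.
rewrite (big_nth 0) size_rcons big_mkord; apply: eq_bigr => k _.
have Hk : k <= size (hi d s) by rewrite -ltnS.
have [Hx Hsz] := size_hi_rcons_hi (ltnW Hd) Hk.
set x := nth 0 _ k in Hx Hsz *.
rewrite Hpre Hsz suf_rcons Hx lo_rcons leqNgt Hx /=.
congr (F _ (rcons _ _) _ _).
(* The first [size l = ncomp w - e] letters of [next w], where w is [suf d s] and e is
   [size (hi d s)], are inaccessible in s; hence the shifted index in [dstep]. *)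
have [l Hl ->] := next_suf Hs (ltnW Hd).
rewrite nth_cat -Hl ifF; last by lia.
have -> : size l + size (hi d s) - size (hi d s) + k - size l = k by lia.
by rewrite (nth_map 0) // size_rcons ltnS.
Qed.

Lemma big_NC_rcons n (G : seq nat -> nat) :
  \sum_(s <- NC n.+1) G s = \sum_(s <- NC n) \sum_(x <- next s) G (rcons s x).
Proof. exact: big_allpairs_dep. Qed.

(** The cut at [nblocks s], whose right factor is empty, is left out; [dist_conv] treats it
    separately. *)
Definition Q n F := \sum_(s <- NC n) \sum_(d < nblocks s) cutF F d s.

Lemma cut_new F n s : s \in NC n ->
  cutF F (nblocks s) (rcons s (nblocks s).+1) = F s [:: 1] (ncomp s) 1.
Proof.
move=> Hs; have Hm := mem_NC_letter Hs; rewrite /cutF.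
have -> : pre (nblocks s) (rcons s (nblocks s).+1) = s.
  by rewrite /pre -cats1 index_cat ifF ?Hm ?ltnn //= eqxx addn0 take_size_cat.
have -> : suf (nblocks s) (rcons s (nblocks s).+1) = [:: 1].
  rewrite suf_rcons leqnn subSnn; suff -> : suf (nblocks s) s = [::] by [].
  apply/nilP; rewrite /nilp size_map size_filter -leqn0 leqNgt -has_count -all_predC.
  by apply/allP => x /nblocks_ge /=; lia.
rewrite lo_rcons hi_rcons leqnn ltnn size_rcons; congr F; rewrite /ncomp /lo /hi.
  by rewrite (@eq_in_filter _ _ predT) ?filter_predT // => y /opens_sub/nblocks_ge ->.
rewrite -filter_predI (@eq_in_filter _ _ pred0) ?filter_pred0 // => y /opens_sub/nblocks_ge H /=.
by rewrite (ltnNge (nblocks s)) H andbF.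
Qed.

(** A cut of a word of length n + 1 is either inherited from the word without its last letter, or
    created by a last letter that starts a block. In the latter case the right factor is [[:: 1]]
    and everything is accessible. *)
Lemma Q_step n F :
  Q n.+1 F = Q n (dstep F) + \sum_(s <- NC n) F s [:: 1] (ncomp s) 1.
Proof.
rewrite /Q big_NC_rcons -big_split /= !big_seq; apply: eq_bigr => s Hs.
have Hm := mem_NC_letter Hs.
transitivity (\sum_(x <- next s) \sum_(d < nblocks s) cutF F d (rcons s x)
   + cutF F (nblocks s) (rcons s (nblocks s).+1)).
  rewrite /next -cats1 !big_cat !big_seq1 -addnA.
  congr (_ + _).
    rewrite !big_seq; apply: eq_bigr => x /opens_sub/nblocks_ge Hx.
    by rewrite nblocks_rcons (maxn_idPl Hx).
  rewrite nblocks_rcons (maxn_idPr (leqnSn _)) big_ord_recr /=; lia.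
rewrite (cut_new _ Hs); congr (_ + _).
rewrite exchange_big /=; apply: eq_bigr => d _; exact: (cut_step _ Hs).
Qed.

(** * Chains and the solution of the recursion *)

(* kap m p q counts the weakly increasing chains of m + 1 points of N x N ending at (p, q).
   Each letter <= d after the cut is recorded as a point: how many components of the left
   factor, and one less than how many of the right factor, are inaccessible afterwards. *)
Fixpoint kap (m p q : nat) : nat :=
  if m is m'.+1 then \sum_(i < p.+1) \sum_(j < q.+1) kap m' i j else 1.

Lemma kap_sym m p q : kap m p q = kap m q p.
Proof.
elim: m p q => //= m IH p q; rewrite exchange_big; apply: eq_bigr => i _.
by apply: eq_bigr => j _; apply: IH.
Qed.

(** Sums [f], at the final accessible counts, over the ways to place m letters [<= d] after the cut,
    for factors with r and s components. The last recorded point (p, q) leaves r - p and s - (q + 1)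
    components accessible. *)
Definition chains (m r s : nat) (f : nat -> nat -> nat) : nat :=
  if m is m'.+1 then \sum_(p < r) \sum_(q < s) kap m' p q * f (r - p) (s - q.+1)
  else f r s.

Lemma chainsD m r s f g :
  chains m r s (fun i e => f i e + g i e) = chains m r s f + chains m r s g.
Proof.
case: m => //= m; rewrite -big_split; apply: eq_bigr => p _.
by rewrite -big_split; apply: eq_bigr => q _; rewrite mulnDr.
Qed.

Lemma chainsZ m r s a f :
  chains m r s (fun i e => a * f i e) = a * chains m r s f.
Proof.
case: m => //= m; rewrite big_distrr; apply: eq_bigr => p _.
by rewrite big_distrr; apply: eq_bigr => q _; rewrite mulnCA.
Qed.

(* chains0 and chains1 split chains according to whether the last letter is <= d or not,
   that is, whether e = 0 or 0 < e. *)
Definition chains0 (m r s : nat) (f : nat -> nat -> nat) : nat :=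
  if m is m'.+1 then \sum_(p < r) kap m' p s.-1 * f (r - p) 0 else 0.
Definition chains1 (m r s : nat) (f : nat -> nat -> nat) : nat :=
  if m is m'.+1 then \sum_(p < r) \sum_(q < s.-1) kap m' p q * f (r - p) (s.-1 - q)
  else f r s.

Lemma chains_split m r s f : 0 < s ->
  chains m r s f = chains0 m r s f + chains1 m r s f.
Proof.
case: s => // s _; case: m => //= m; rewrite -big_split; apply: eq_bigr => p _ /=.
by rewrite big_ord_recr /= subnn addnC.
Qed.

Lemma triangle_sum s (h : nat -> nat -> nat) :
  \sum_(q < s) \sum_(k < s - q) h q (q.+1 + k) =
  \sum_(j < s.+1) \sum_(q < j) h q j.
Proof.
elim: s => [|s IH]; first by rewrite big_ord0 big_ord_recl big_ord0 big_ord0.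
rewrite [RHS]big_ord_recr /= -IH [in RHS]big_ord_recr /= big_ord_recr /= subSnn big_ord1 addn0.
rewrite addnA; congr (_ + _); rewrite -big_split; apply: eq_bigr => q _ /=.
by rewrite subSn ?big_ord_recr /= ?addSn ?subnKC // ltnW.
Qed.

Lemma rev_sum r (g : nat -> nat) : \sum_(k < r) g k.+1 = \sum_(k < r) g (r - k).
Proof.
rewrite (reindex_inj rev_ord_inj) /=; apply: eq_bigr => k _; congr g.
by have := ltn_ord k; lia.
Qed.

(** The new letter [<= d] becomes the last point of the chain. All of the right factor precedes it,
    so its right coordinate is s - 1 and no component of that factor stays accessible. *)
Lemma chains_below m r s (f : nat -> nat -> nat) : 0 < s ->
  chains m r s (fun i e => \sum_(k < i) f k.+1 0) = chains0 m.+1 r s f.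
Proof.
case: s => // s _; case: m => [|m] /=.
  by rewrite (rev_sum r (f^~ 0)); apply: eq_bigr => p _; rewrite mul1n.
(* Here q is the left coordinate of the previous last point, i its right coordinate, and j - 1 the
   left coordinate of the new point. *)
pose h q j := (\sum_(i < s.+1) kap m q i) * f (r.+1 - j) 0.
transitivity (\sum_(q < r) \sum_(k < r - q) h q (q.+1 + k)).
  apply: eq_bigr => p _; rewrite -big_distrl /= (rev_sum (r - p) (f^~ 0)) big_distrr /=.
  by apply: eq_bigr => k _; rewrite /h; congr (_ * f _ _); lia.
rewrite triangle_sum big_ord_recl big_ord0 add0n; apply: eq_bigr => p _.
by rewrite /h lift0 subSS -big_distrl.
Qed.

(** Each word of length l + 1 comes from a unique w and a unique index j in [next w]. If the last
    point has right coordinate q, the first q + 1 components are inaccessible, so exactly the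
    indices j > q are allowed. *)
Lemma chains_above m l r (G : seq nat -> nat -> nat -> nat) :
  \sum_(w <- NC l) chains m r (ncomp w)
     (fun i e => \sum_(k < e.+1) G (rcons w (nth 0 (next w) (ncomp w - e + k))) i k.+1) =
  \sum_(w <- NC l.+1) chains1 m r (ncomp w) (G w).
Proof.
rewrite big_NC_rcons; apply: eq_bigr => w _.
rewrite (big_nth 0) big_mkord size_next.
transitivity (\sum_(j < (ncomp w).+1)
    chains1 m r j.+1 (G (rcons w (nth 0 (next w) j)))); last first.
  by apply: eq_bigr => j _; rewrite ncomp_rcons_next // -ltnS.
case: m => [|m] /=; first by rewrite subnn.
rewrite [RHS]exchange_big /=; apply: eq_bigr => p _.
rewrite -(@triangle_sum _ (fun q j => kap m p q * G (rcons w (nth 0 (next w) j)) (r - p) (j - q))).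
apply: eq_bigr => q _; rewrite big_distrr /=.
have Hq := ltn_ord q; have -> : (ncomp w - q.+1).+1 = ncomp w - q by lia.
apply: eq_bigr => k _; congr (_ * G (rcons w (nth 0 (next w) _)) _ _); lia.
Qed.

(** Total over all continuations of the left factor u by j + 1 letters: l + 1 of them form the right
    factor w, the other j - l are [<= d]. *)
Definition Z j F u := \sum_(l < j.+1) \sum_(w <- NC l.+1)
  chains (j - l) (ncomp u) (ncomp w) (F u w).

Lemma ncomp_gt0 n s : s \in NC n.+1 -> 0 < ncomp s.
Proof.
case/lastP: s => [/size_NC//|s x _]; by rewrite /ncomp opens_rcons size_rcons.
Qed.

Lemma NC1 : NC 1 = [:: [:: 1]]. Proof. by []. Qed.

(** Splits by the type of the last letter. The boundary terms vanish: with no letter [<= d] after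
    the cut none can be last, and a right factor of length 1 is the first letter after the cut, so
    it is not last when others follow. *)
Lemma Z_step j F u : Z j (dstep F) u = Z j.+1 F u.
Proof.
pose E0 l := \sum_(w <- NC l.+1) chains0 (j.+1 - l) (ncomp u) (ncomp w) (F u w).
pose E1 l := \sum_(w <- NC l.+1) chains1 (j.+1 - l) (ncomp u) (ncomp w) (F u w).
transitivity (\sum_(l < j.+2) E0 l + \sum_(l < j.+2) E1 l); last first.
  rewrite -big_split; apply: eq_bigr => l _ /=; rewrite /E0 /E1 -big_split /= !big_seq.
  by apply: eq_bigr => w /ncomp_gt0 Hw; rewrite -chains_split.
rewrite [in X in _ = X + _]big_ord_recr [in X in _ = _ + X]big_ord_recl /=.
have -> : E0 j.+1 = 0 by rewrite /E0 subnn big1.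
have -> : E1 0 = 0.
  by rewrite /E1 NC1 big_seq1 subn0 /= big1 // => p _; rewrite big_ord0.
rewrite addn0 add0n -big_split; apply: eq_bigr => l _ /=.
rewrite /E0 /E1 /bump /= add1n subSS -chains_above -big_split /= !big_seq.
apply: eq_bigr => w /ncomp_gt0 Hw; rewrite /dstep chainsD chains_below //.
by rewrite subSn // -ltnS.
Qed.

Lemma Z0 F u : Z 0 F u = F u [:: 1] (ncomp u) 1.
Proof. by rewrite /Z big_ord1 NC1 big_seq1. Qed.

(** Unrolls [Q_step]: a cut created after a left factor of length t is followed through the
    remaining n - t letters by [Z_step]. *)
Lemma Q_formula n F : Q n.+1 F = \sum_(t < n.+1) \sum_(u <- NC t) Z (n - t) F u.
Proof.
elim: n F => [|n IH] F; rewrite Q_step.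
  rewrite /Q !big_seq1 big_ord0 big_ord1 big_seq1 add0n; by rewrite Z0.
rewrite IH [RHS]big_ord_recr /= subnn; congr (_ + _).
  apply: eq_bigr => t _; apply: eq_bigr => u _; rewrite Z_step subSn // -ltnS //.
by apply: eq_bigr => u _; rewrite Z0.
Qed.

(** * Convolution and its commutativity in distribution *)

Definition dist (X : seq nat -> nat) (n c : nat) : nat :=
  \sum_(s <- NC n) X s * (ncomp s == c).

Definition conv (X Y : seq nat -> nat) (s : seq nat) : nat :=
  \sum_(d < (nblocks s).+1) X (pre d s) * Y (suf d s).

Definition K (m r s c : nat) : nat := chains m r s (fun i e => (i + e == c)).

(** Transposing chains exchanges p and q, and the final number of components, r + s - 1 - p - q,
    does not change (for m = 0 it is r + s). *)
Lemma K_sym m r s c : K m r s c = K m s r c.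
Proof.
case: m => [|m]; rewrite /K /=; first by rewrite addnC.
rewrite exchange_big; apply: eq_bigr => p _; apply: eq_bigr => q _.
rewrite kap_sym; congr (_ * nat_of_bool (_ == _)).
by have := ltn_ord p; have := ltn_ord q; lia.
Qed.

Lemma pre_nblocks s : pre (nblocks s) s = s.
Proof. by rewrite pre_notin //; apply/negP => /nblocks_ge; rewrite ltnn. Qed.

Lemma suf_nblocks s : suf (nblocks s) s = [::].
Proof.
apply/nilP; rewrite /nilp size_map size_filter -leqn0 leqNgt -has_count -all_predC.
by apply/allP => x /nblocks_ge /=; rewrite -leqNgt.
Qed.

(** The kernel [K] sees the factors only through their lengths and numbers of components, so the
    right side depends on X and Y only through their [dist], and [K_sym] makes it symmetric. *)
Lemma dist_conv X Y n c : dist (conv X Y) n c =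
  \sum_(t < n.+1) \sum_(l < n.+1 | t + l <= n)
   \sum_(u <- NC t) X u * \sum_(w <- NC l) Y w * K (n - t - l) (ncomp u) (ncomp w) c.
Proof.
pose F u w i e := X u * Y w * (i + e == c).
transitivity (Q n F + \sum_(u <- NC n) X u * (Y [::] * (ncomp u == c))).
  rewrite /dist /Q -big_split /=; apply: eq_bigr => s _.
  rewrite /conv big_ord_recr /= pre_nblocks suf_nblocks mulnDl big_distrl /= mulnA.
  congr (_ + _); apply: eq_bigr => d _; by rewrite /cutF /F -ncomp_lo_hi.
transitivity (\sum_(t < n.+1) \sum_(u <- NC t) X u *
   \sum_(l < (n - t).+1) \sum_(w <- NC l) Y w * K (n - t - l) (ncomp u) (ncomp w) c); last first.
  apply: eq_bigr => t _; rewrite exchange_big /=; apply: eq_bigr => u _.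
  rewrite -big_distrr /=; congr (_ * _).
  rewrite (big_ord_widen n.+1 
    (fun l => \sum_(w <- NC l) Y w * K (n - t - l) (ncomp u) (ncomp w) c)) ?ltnS ?leq_subr //.
  by apply: eq_bigl => l; have := ltn_ord t; lia.
transitivity (\sum_(t < n.+1)
   (\sum_(u <- NC t) X u * (Y [::] * K (n - t) (ncomp u) 0 c) +
    \sum_(u <- NC t) X u * \sum_(l < n - t) \sum_(w <- NC l.+1)
       Y w * K (n - t - l.+1) (ncomp u) (ncomp w) c)); last first.
  apply: eq_bigr => t _; rewrite -big_split; apply: eq_bigr => u _ /=.
  by rewrite big_ord_recl big_seq1 mulnDr subn0.
(* For an empty right factor only t = n contributes: [K] is 0 when s = 0 and letters remain after
   the left factor. *)
rewrite big_split /= addnC; congr (_ + _).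
  rewrite big_ord_recr /= subnn [X in _ = X + _]big1 ?add0n => [|t _].
    by apply: eq_bigr => u _; rewrite /K /= addn0.
  rewrite big1 // => u _; have := ltn_ord t; rewrite -subn_gt0.
  case: (n - t) => // m _; rewrite /K /= big1 ?muln0 // => p _; by rewrite big_ord0.
case: n => [|n]; first by rewrite /Q !big_seq1 big_ord0 big_ord1 big_seq1 big_ord0 muln0.
rewrite Q_formula [RHS]big_ord_recr /= [X in _ = _ + X]big1 ?addn0; last first.
  by move=> u _; rewrite subnn big_ord0 muln0.
apply: eq_bigr => t _; apply: eq_bigr => u _; rewrite /Z subSn -1?ltnS // big_distrr /=.
apply: eq_bigr => l _; rewrite big_distrr /=; apply: eq_bigr => w _.
by rewrite subSS /F chainsZ mulnA.
Qed.

Definition equid (X Y : seq nat -> nat) : Prop := forall n c, dist X n c = dist Y n c.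

Lemma ncomp_le_size s : ncomp s <= size s.
Proof.
elim/last_ind: s => // s x IH.
rewrite /ncomp opens_rcons !size_rcons ltnS size_filter.
exact: leq_trans (count_size _ _) IH.
Qed.

Lemma sum_dist X n (G : nat -> nat) :
  \sum_(s <- NC n) X s * G (ncomp s) = \sum_(c < n.+1) dist X n c * G c.
Proof.
under [RHS]eq_bigr => c _ do rewrite big_distrl.
rewrite exchange_big /= !big_seq; apply: eq_bigr => s /size_NC Hs.
have Hc : ncomp s < n.+1 by rewrite ltnS -Hs ncomp_le_size.
rewrite (bigD1 (Ordinal Hc)) //= eqxx muln1 big1 ?addn0 // => c Hc'.
rewrite (_ : (ncomp s == c) = false) ?muln0 //.
by apply/negP => /eqP E; case/eqP: Hc'; apply: val_inj.
Qed.

Lemma equid_sum X X' n G : equid X X' ->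
  \sum_(s <- NC n) X s * G (ncomp s) = \sum_(s <- NC n) X' s * G (ncomp s).
Proof. by move=> H; rewrite !sum_dist; apply: eq_bigr => c _; rewrite H. Qed.

Lemma conv_equid X X' Y Y' : equid X X' -> equid Y Y' -> equid (conv X Y) (conv X' Y').
Proof.
move=> HX HY n c; rewrite !dist_conv; apply: eq_bigr => t _; apply: eq_bigr => l _.
rewrite (equid_sum _ (fun r => \sum_(w <- NC l) Y w * K (n - t - l) r (ncomp w) c) HX).
apply: eq_bigr => u _; congr (_ * _).
exact: (equid_sum _ (fun s => K (n - t - l) (ncomp u) s c) HY).
Qed.

Lemma conv_comm X Y : equid (conv X Y) (conv Y X).
Proof.
move=> n c; rewrite !dist_conv (exchange_big_dep predT) //=.
apply: eq_bigr => l _; apply: eq_big => [t|t _]; first by rewrite addnC.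
under eq_bigr => u _ do rewrite big_distrr.
rewrite exchange_big; apply: eq_bigr => w _; rewrite big_distrr /=.
by apply: eq_bigr => u _; rewrite K_sym mulnCA subnAC.
Qed.

Lemma eq_dist X Y n c : {in NC n, X =1 Y} -> dist X n c = dist Y n c.
Proof. by move=> H; rewrite /dist !big_seq; apply: eq_bigr => s /H->. Qed.

(** * Sums over consecutive pairs of cuts *)

Definition one_block (s : seq nat) : nat := nblocks s == 1.

(** Arises from a double convolution with [one_block] in the middle, which forces the two cuts to be
    consecutive. *)
Definition conv_step (X Y : seq nat -> nat) (s : seq nat) : nat :=
  \sum_(d < nblocks s) X (pre d s) * Y (suf d.+1 s).

Lemma suf_suf d s : suf 1 (suf d s) = suf d.+1 s.
Proof.
elim/last_ind: s => // s x IH; rewrite !suf_rcons.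
case: (ltnP d x) => H; last by rewrite ifF //; apply/negbTE; lia.
have E : (1 < x - d) = (d.+1 < x) by lia.
by rewrite suf_rcons IH E -subnDA addn1.
Qed.

Lemma pre_pre n d s : s \in NC n -> d < nblocks s -> pre d (pre d.+1 s) = pre d s.
Proof.
move=> Hs Hd.
have Hin : d.+1 \in pre d.+1 s by rewrite (mem_NC_letter (pre_NC _ Hs)) (nblocks_pre Hs) //; lia.
have E : index d.+1 s = index d.+1 (pre d.+1 s).
  by rewrite -{1}(cat_take_drop (index d.+2 s) s) index_cat Hin.
rewrite /pre -/(pre d.+1 s) -E /pre take_takel // E.
by apply: leq_trans (index_size _ _) _; rewrite size_take_min geq_minl.
Qed.

Lemma conv_one_l n Y s : s \in NC n ->
  conv one_block Y s = if 0 < nblocks s then Y (suf 1 s) else 0.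
Proof.
move=> Hs; rewrite /conv.
under eq_bigr => d _ do rewrite /one_block (nblocks_pre Hs) -1?ltnS //.
case: ifP => H.
  have H1 : 1 < (nblocks s).+1 by lia.
  rewrite (bigD1 (Ordinal H1)) //= mul1n big1 ?addn0 // => d Hd.
  rewrite (_ : (nat_of_ord d == 1) = false) ?mul0n //; exact: negbTE.
by rewrite big1 // => d _; rewrite (_ : (nat_of_ord d == 1) = false) //; have := ltn_ord d; lia.
Qed.

Lemma conv_one_r n X s : s \in NC n ->
  conv X one_block s = if 0 < nblocks s then X (pre (nblocks s).-1 s) else 0.
Proof.
move=> Hs; rewrite /conv.
under eq_bigr => d _ do rewrite /one_block nblocks_suf.
case: ifP => H.
  have H1 : (nblocks s).-1 < (nblocks s).+1 by lia.
  rewrite (bigD1 (Ordinal H1)) //= (_ : _ - _ = 1) ?muln1 ?big1 ?addn0 //; last by lia.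
  move=> d Hd; rewrite (_ : (_ - nat_of_ord d == 1) = false) ?muln0 //.
  apply/negP => /eqP E; case/eqP: Hd; apply: val_inj => /=; lia.
by rewrite big1 // => d _; rewrite (_ : (_ - nat_of_ord d == 1) = false) ?muln0 //; lia.
Qed.

Lemma conv_stepl n X Y s : s \in NC n -> conv X (conv one_block Y) s = conv_step X Y s.
Proof.
move=> Hs; rewrite {1}/conv big_ord_recr /= suf_nblocks.
rewrite (@conv_one_l 0) // muln0 addn0; apply: eq_bigr => d _.
by rewrite (conv_one_l _ (suf_NC _ Hs)) nblocks_suf subn_gt0 ltn_ord suf_suf.
Qed.

Lemma conv_stepr n X Y s : s \in NC n -> conv (conv X one_block) Y s = conv_step X Y s.
Proof.
move=> Hs; rewrite {1}/conv big_ord_recl.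
rewrite (conv_one_r _ (pre_NC _ Hs)) (nblocks_pre Hs) // ltnn mul0n add0n.
apply: eq_bigr => d _; rewrite (conv_one_r _ (pre_NC _ Hs)) (nblocks_pre Hs) ?ltn_ord //.
by rewrite lift0 (pre_pre Hs) ?ltn_ord.
Qed.

(** Both bracketings of X, [one_block], Y compute [conv_step X Y]. Writing 1 for [one_block], X * (1
    * Y) is equidistributed with (1 * Y) * X, and this with (Y * 1) * X. *)
Lemma conv_step_comm X Y : equid (conv_step X Y) (conv_step Y X).
Proof.
move=> n c.
rewrite -(eq_dist _ (fun s => @conv_stepl n X Y s)) -(eq_dist _ (fun s => @conv_stepr n Y X s)).
rewrite conv_comm; apply: conv_equid => //; exact: conv_comm.
Qed.

Lemma conv_step_equid X X' Y Y' : equid X X' -> equid Y Y' ->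
  equid (conv_step X Y) (conv_step X' Y').
Proof.
move=> HX HY n c.
rewrite -(eq_dist _ (fun s => @conv_stepl n X Y s)) -(eq_dist _ (fun s => @conv_stepl n X' Y' s)).
by do 2!apply: conv_equid => //.
Qed.

(** * Euler characteristic of an interval of cuts *)

(* The cuts d such that a d and b d both hold form an interval; its Euler
   characteristic (points minus steps) is 1 unless it is empty. *)
Lemma interval_euler N (a b : nat -> bool) :
  (forall d, d < N -> a d -> a d.+1) -> (forall d, d < N -> b d.+1 -> b d) ->
  [exists d : 'I_N.+1, a d && b d] + \sum_(d < N) a d * b d.+1 =
  \sum_(d < N.+1) a d * b d.
Proof.
elim: N => [|N IH] Ha Hb.
  rewrite big_ord0 big_ord1 addn0 mulnb; congr nat_of_bool.
  apply/existsP/idP => [[d]|H]; last by exists ord0.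
  by rewrite (ord1 d).
have {}IH := IH (fun d H => Ha d (ltnW H)) (fun d H => Hb d (ltnW H)).
rewrite big_ord_recr [RHS]big_ord_recr /= -IH !mulnb.
have -> : [exists d : 'I_N.+2, a d && b d] =
    [exists d : 'I_N.+1, a d && b d] || (a N.+1 && b N.+1).
  apply/existsP/orP => [[d Hd]|[/existsP[d Hd]|H]].
  - have [E|E] := ltnP d N.+1; first by left; apply/existsP; exists (Ordinal E).
    right; suff -> : N.+1 = d by [].
    by apply/eqP; rewrite eqn_leq E -ltnS ltn_ord.
  - by exists (widen_ord (leqnSn _) d).
  - by exists ord_max.
have Hmono : forall d, d <= N -> a d -> a N.
  move=> d Hd Had; rewrite -(subnKC Hd).
  have: d + (N - d) <= N by rewrite subnKC.
  elim: (N - d) => [|k IHk]; first by rewrite addn0.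
  by rewrite addnS => Hk; apply: Ha; [lia|apply: IHk; lia].
(* With a step from N to N + 1, both ends are points of the interval, so the new point and the new
   step cancel. *)
case HN: (a N && b N.+1).
  case/andP: HN => HaN HbN; rewrite (Ha _ (ltnSn _) HaN) HbN orbT.
  have -> : [exists d : 'I_N.+1, a d && b d].
    by apply/existsP; exists ord_max; rewrite /= HaN Hb.
  by rewrite addnA.
(* Without that step, N + 1 can only be the first point: [b N.+1] excludes [a N], and by
   monotonicity [a d] for every earlier d. *)
case HS: (a N.+1 && b N.+1); last by rewrite orbF !addn0.
have -> : [exists d : 'I_N.+1, a d && b d] = false.
  apply/negbTE/existsP => -[d /andP[Hd _]]; case/andP: HS => _ HbS.
  by rewrite HbS (Hmono d) // -ltnS // in HN.
by rewrite add0n addn0 addnC.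
Qed.

(** * Order isomorphism and pattern containment *)

Lemma order_isoP x p : reflect (size x = size p /\
    forall i j, i < size p -> j < size p ->
      (nth 0 x i < nth 0 x j) = (nth 0 p i < nth 0 p j)) (order_iso x p).
Proof.
apply: (iffP andP) => [[/eqP-> /allP H]|[-> H]]; split=> //.
  move=> i j Hi Hj; have := H i; rewrite mem_iota => /(_ Hi)/allP/(_ j).
  by rewrite mem_iota => /(_ Hj)/eqP.
apply/allP => i; rewrite mem_iota => Hi; apply/allP => j; rewrite mem_iota => Hj.
by rewrite H.
Qed.

Lemma order_iso_map (f : nat -> nat) x p :
  {in x &, forall a b, (f a < f b) = (a < b)} -> order_iso (map f x) p = order_iso x p.
Proof.
move=> Hf; apply/order_isoP/order_isoP; rewrite size_map => -[Hs H]; split=> // i j Hi Hj;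
  rewrite -H //; rewrite -?Hs in Hi Hj; by rewrite !(nth_map 0) // Hf ?mem_nth.
Qed.

Lemma order_iso_mapr (f : nat -> nat) x p :
  {in p &, forall a b, (f a < f b) = (a < b)} -> order_iso x (map f p) = order_iso x p.
Proof.
move=> Hf; apply/order_isoP/order_isoP; rewrite size_map => -[Hs H]; split=> // i j Hi Hj;
  by rewrite H // !(nth_map 0) // Hf ?mem_nth.
Qed.

Lemma order_iso_cat x1 x2 p1 p2 :
  size x1 = size p1 -> (forall a b, a \in p1 -> b \in p2 -> a < b) ->
  order_iso (x1 ++ x2) (p1 ++ p2) <->
  [/\ order_iso x1 p1, order_iso x2 p2 & forall a b, a \in x1 -> b \in x2 -> a < b].
Proof.
move=> Hs Hp; split.
  case/order_isoP; rewrite !size_cat Hs => /addnI Hs2 H.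
  have nl i l (l1 l2 : seq nat) : size l1 = l -> i < l -> nth 0 (l1 ++ l2) i = nth 0 l1 i.
    by move=> <- Hi; rewrite nth_cat Hi.
  have nr i l (l1 l2 : seq nat) : size l1 = l -> nth 0 (l1 ++ l2) (l + i) = nth 0 l2 i.
    by move=> <-; rewrite nth_cat ltnNge leq_addr addKn.
  split.
  - apply/order_isoP; split=> // i j Hi Hj.
    by have := H i j (ltn_addr _ Hi) (ltn_addr _ Hj); rewrite !(nl _ (size p1)).
  - apply/order_isoP; split=> // i j Hi Hj.
    by have := H (size p1 + i) (size p1 + j); rewrite !ltn_add2l !(nr _ (size p1)) //; apply.
  - move=> a b /(nthP 0)[i Hi <-] /(nthP 0)[j Hj <-].
    rewrite Hs in Hi; rewrite Hs2 in Hj.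
    have := H i (size p1 + j); rewrite ltn_add2l !(nl i (size p1)) // !(nr _ (size p1)) // => ->.
    + by apply: Hp; apply: mem_nth.
    + exact: ltn_addr.
    + exact: Hj.
case=> /order_isoP[_ H1] /order_isoP[Hs2 H2] H3.
apply/order_isoP; rewrite !size_cat Hs Hs2; split=> // i j Hi Hj.
rewrite !nth_cat Hs; case: (ltnP i (size p1)) => Ei; case: (ltnP j (size p1)) => Ej.
- exact: H1.
- have Hj2 : j - size p1 < size p2 by rewrite ltn_subLR.
  by rewrite H3 ?Hp ?mem_nth ?Hs ?Hs2.
- have Hi2 : i - size p1 < size p2 by rewrite ltn_subLR.
  have X1 : nth 0 x1 j < nth 0 x2 (i - size p1) by rewrite H3 ?mem_nth ?Hs ?Hs2.
  have X2 : nth 0 p1 j < nth 0 p2 (i - size p1) by rewrite Hp ?mem_nth ?Hs ?Hs2.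
  by rewrite (ltnNge (nth 0 x2 _)) (ltnNge (nth 0 p2 _)) (ltnW X1) (ltnW X2).
- by apply: H2; rewrite ltn_subLR.
Qed.

Definition cont (s p : seq nat) : bool :=
  [exists m : (size s).-tuple bool, order_iso (mask m s) p].

Lemma contP s p : reflect (exists2 x, subseq x s & order_iso x p) (cont s p).
Proof.
apply: (iffP existsP) => [[m Hm]|[x /subseqP[m Hm ->] Hx]].
  by exists (mask m s) => //; apply: mask_subseq.
have Hm' : size m == size s by apply/eqP.
by exists (Tuple Hm').
Qed.

Lemma containsP s p : reflect (contains s p) (cont s p).
Proof.
apply: (iffP (contP _ _)) => [[x /subseqP[m Hm ->] Hx]|[m [Hm Hx]]]; first by exists m.
by exists (mask m s) => //; apply: mask_subseq.
Qed.

Lemma cont_subseq s t p : subseq s t -> cont s p -> cont t p.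
Proof.
move=> Hs /contP[x Hx Ho]; apply/contP; exists x => //; exact: subseq_trans Hx Hs.
Qed.

Lemma cont_suf d s p :
  cont (suf d s) p <-> exists x, [/\ subseq x s, all (ltn d) x & order_iso x p].
Proof.
have Hiso x : all (ltn d) x -> order_iso (map (subn^~ d) x) p = order_iso x p.
  move=> /allP Hx; apply: order_iso_map => a b /Hx Ha /Hx Hb; rewrite /= in Ha Hb.
  by rewrite ltn_sub2rE // ltnW.
split.
  case/contP => x /subseqP[m _ ->]; rewrite /suf -map_mask => Hm.
  have Hsub := mask_subseq m [seq y <- s | d < y].
  move: Hsub; rewrite subseq_filter => /andP[Ha Hsub].
  exists (mask m [seq y <- s | d < y]); split=> //.
  by rewrite -Hiso.
case=> x [Hx Ha Ho]; apply/contP; exists (map (subn^~ d) x); last by rewrite Hiso.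
by apply: map_subseq; rewrite subseq_filter Hx andbT.
Qed.

Lemma cont_suf_le d e s p : d <= e -> cont (suf e s) p -> cont (suf d s) p.
Proof.
move=> Hde /cont_suf[x [Hx /allP Ha Ho]]; apply/cont_suf; exists x; split=> //.
by apply/allP => y /Ha /=; apply: leq_ltn_trans.
Qed.

Lemma pre_le n d e s : s \in NC n -> d <= e -> e <= nblocks s -> subseq (pre d s) (pre e s).
Proof.
move=> Hs Hde He; rewrite -(subnKC Hde).
have: d + (e - d) <= nblocks s by rewrite subnKC.
elim: (e - d) => [|k IHk]; first by rewrite addn0.
rewrite addnS => Hk; apply: subseq_trans (IHk (ltnW Hk)) _.
by rewrite -(pre_pre Hs Hk); apply: take_subseq.
Qed.

(** * Absence of crossings and containment of a bracketed pattern *)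

Lemma subseq_rcons2 (p s : seq nat) a x :
  subseq (rcons p a) (rcons s x) = if a == x then subseq p s else subseq (rcons p a) s.
Proof.
rewrite -subseq_rev !rev_rcons /=; case: eqP => _; first exact: subseq_rev.
by rewrite -(subseq_rev (rcons p a)) rev_rcons.
Qed.

(** The second claim carries the induction: the second c closes D, and a closed letter never becomes
    open again. *)
Lemma NC_no_crossing n s : s \in NC n -> forall c D, c < D ->
  ~~ subseq [:: c; D; c; D] s /\ (subseq [:: c; D; c] s -> D \notin opens s).
Proof.
move: n s; apply: NC_ind => [|n s x Hs IH Hx] c D HcD //.
have [H1 H2] := IH c D HcD.
have Hno : subseq [:: c; D; c] s -> D != x.
  move=> H; apply/eqP => E; move: Hx; rewrite -E mem_rcons inE (negbTE (H2 H)) orbF => /eqP HD.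
  have : D \in s by apply: (mem_subseq H); rewrite !inE eqxx orbT.
  by rewrite (mem_NC_letter Hs) HD ltnn andbF.
rewrite (subseq_rcons2 [:: c; D; c]) (subseq_rcons2 [:: c; D]); split.
  by case: eqP => [E|//]; apply/negP => /Hno; rewrite E eqxx.
rewrite opens_rcons mem_rcons inE mem_filter; case: (c =P x) => [E _|_ H].
  by rewrite -E; apply/negP => /orP[|/andP[]]; lia.
by rewrite (negbTE (Hno H)) (negbTE (H2 H)) andbF.
Qed.

Lemma subseq_cat_split (T : eqType) (x1 x2 s : seq T) : subseq (x1 ++ x2) s ->
  exists s1 s2, [/\ s = s1 ++ s2, subseq x1 s1 & subseq x2 s2].
Proof.
elim: s x1 => [|y s IH] [|a x1] //=.
- by move=> H; exists [::], [::].
- by move=> H; exists [::], (y :: s).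
- case: eqP => [->|Ne] H; last first.
    have [s1 [s2 [-> H1 H2]]] := IH (a :: x1) H.
    by exists (y :: s1), s2; split=> //=; case: eqP.
  have [s1 [s2 [-> H1 H2]]] := IH x1 H.
  by exists (y :: s1), s2; split=> //=; rewrite eqxx.
Qed.

Lemma subseq_disjoint (T : eqType) (x u v : seq T) : subseq x (u ++ v) ->
  (forall a, a \in x -> a \notin v) -> subseq x u.
Proof.
elim: u x => [|y u IH] [|a x] //=.
- by move=> /mem_subseq H /(_ a (mem_head _ _)); rewrite H ?mem_head.
- case: eqP => _ H Hv; apply: IH => // b Hb; apply: Hv => //; by rewrite inE Hb orbT.
Qed.

Lemma NC_letter_gt0 n s : s \in NC n -> all (leq 1) s.
Proof. by move=> Hs; apply/allP => x; rewrite (mem_NC_letter Hs) => /andP[]. Qed.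

Lemma exists_min (x : seq nat) : x != [::] -> exists2 D, D \in x & all (leq D) x.
Proof.
elim: x => // a [|b x] IH _; first by exists a; rewrite ?mem_head //= leqnn.
have [D HD HA] := IH isT; have [H|H] := leqP a D.
  exists a; rewrite ?mem_head //=; rewrite leqnn /=.
  by apply: sub_all HA => y; apply: leq_trans.
by exists D; [rewrite inE HD orbT|rewrite /= (ltnW H)].
Qed.

(** Given an occurrence [x1 ++ x2], let D be the least letter of [x2] and cut at D - 1. A letter c
    of [x1] placed after the first D would give the crossing c D c D, as every letter below D also
    occurs before the first D. *)
Lemma cont_bracket n s a b : s \in NC n -> all (leq 1) b ->
  cont s (bracket a b) =
  [exists d : 'I_(nblocks s).+1, cont (pre d s) a && cont (suf d s) b].
Proof.
move=> Hs /allP Hb.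
have Hab : forall x y, x \in a -> y \in map (addn (nblocks a)) b -> x < y.
  by move=> x y /nblocks_ge Hx /mapP[z /Hb Hz ->]; rewrite -addn1 leq_add.
have Hsh x : order_iso x (map (addn (nblocks a)) b) = order_iso x b.
  by apply: order_iso_mapr => u v _ _; rewrite ltn_add2l.
apply/contP/existsP; last first.
  case=> d /andP[/contP[x1 H1 O1] /cont_suf[x2 [H2 /allP A2 O2]]].
  have Hd : d <= nblocks s by rewrite -ltnS.
  exists (x1 ++ x2).
    rewrite -(cat_take_drop (index d.+1 s) s); apply: cat_subseq => //.
    set k := index _ _ in H1 *.
    have : subseq x2 [seq y <- s | d < y] by rewrite subseq_filter H2 andbT; apply/allP.
    have -> : [seq y <- s | d < y] = [seq y <- take k s | d < y] ++ [seq y <- drop k s | d < y].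
      by rewrite -filter_cat cat_take_drop.
    rewrite (@eq_in_filter _ _ pred0) ?filter_pred0 /=.
      by move=> H; apply: subseq_trans H (filter_subseq _ _).
    move=> y Hy; have : y <= nblocks (pre d s) by apply: nblocks_ge.
    by rewrite (nblocks_pre Hs) //= leqNgt => /negbTE.
  apply/order_iso_cat => //; first by case/order_isoP: O1.
  split=> //; first by rewrite Hsh.
  move=> u v /(mem_subseq H1)/nblocks_ge; rewrite (nblocks_pre Hs) // => Hu /A2 /=.
  exact: leq_ltn_trans.
case=> x Hx Ho.
have Hsz : size (take (size a) x) = size a.
  by case/order_isoP: Ho; rewrite size_cat => Hx' _; rewrite size_takel // Hx' leq_addr.
move: Hx Ho; rewrite -(cat_take_drop (size a) x).
move: (take _ x) (drop _ x) Hsz => x1 x2 Hsz Hx /(order_iso_cat _ Hsz Hab)[O1 O2 Hlt].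
rewrite Hsh in O2.
have [s1 [s2 [Es H1 H2]]] := subseq_cat_split Hx.
(* An empty [x2] has no least letter; the cut after the whole word serves instead. *)
case: (x2 =P [::]) => [E2|/eqP N2].
  exists ord_max; rewrite /= pre_nblocks suf_nblocks; apply/andP; split; apply/contP.
    by exists x1 => //; rewrite Es; apply: subseq_trans H1 (prefix_subseq _ _).
  by exists [::]; rewrite // -E2.
have [D HD /allP Dmin] := exists_min N2.
have HDs2 := mem_subseq H2 HD.
have HDs : D \in s by rewrite Es mem_cat HDs2 orbT.
have /andP[D0 DN] : 0 < D <= nblocks s by rewrite -(mem_NC_letter Hs).
have Hd : D.-1 < (nblocks s).+1 by rewrite ltnS (leq_trans (leq_pred _)).
exists (Ordinal Hd) => /=; apply/andP; split; last first.
  apply/cont_suf; exists x2; split=> //.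
    by rewrite Es; apply: subseq_trans H2 (suffix_subseq _ _).
  by apply/allP => y /Dmin /=; rewrite prednK.
apply/contP; exists x1 => //.
have Hpre c : (c \in pre D.-1 s) = (0 < c < D).
  rewrite (mem_NC_letter (pre_NC _ Hs)) (nblocks_pre Hs) //.
  by rewrite -(ltnS c) prednK.
(* If the first D is not in [s1], then all of [s1], and with it [x1], precedes the cut. *)
rewrite /pre prednK //; have [Hk|Hk] := leqP (size s1) (index D s).
  rewrite Es take_cat -Es ltnNge Hk /=.
  exact: subseq_trans H1 (prefix_subseq _ _).
have Etake : take (index D s) s = take (index D s) s1 by rewrite {2}Es takel_cat // ltnW.
rewrite Etake; move: H1; rewrite -{1}(cat_take_drop (index D s) s1) => H1.
apply: (subseq_disjoint H1) => c Hc; apply/negP => Hcd.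
have HcD : c < D by apply: Hlt.
have Hc0 : 0 < c.
  have : c \in s by rewrite Es -(cat_take_drop (index D s) s1) !mem_cat Hcd orbT.
  by rewrite (mem_NC_letter Hs) => /andP[].
have HDin : D \in s1.
  by apply/negPn/negP => Hn; move: Hk; rewrite Es index_cat (negbTE Hn) ltnNge leq_addr.
have Edrop : drop (index D s) s1 = D :: drop (index D s).+1 s1.
  by rewrite (drop_nth 0 Hk); congr cons; rewrite Es index_cat HDin nth_index.
have [/negP + _] := NC_no_crossing Hs HcD; apply.
rewrite Es -(cat_take_drop (index D s) s1) Edrop -catA.
apply: (@cat_subseq _ [:: c]); first
  by rewrite sub1seq -Etake; have := Hpre c; rewrite /pre prednK // => ->; rewrite Hc0.
rewrite /= eqxx; apply: (@cat_subseq _ [:: c] [:: D]); rewrite sub1seq //.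
move: Hcd; rewrite Edrop inE => /orP[/eqP E|//]; by rewrite E ltnn in HcD.
Qed.

(** * Equidistribution of bracketed patterns *)

Definition contn (p s : seq nat) : nat := cont s p.

Lemma cont_bracket_euler n s a b : s \in NC n -> all (leq 1) b ->
  contn (bracket a b) s + conv_step (contn a) (contn b) s = conv (contn a) (contn b) s.
Proof.
move=> Hs Hb; rewrite /contn (cont_bracket _ Hs Hb).
(* As d grows, [pre d s] gains letters and [suf d s] loses them, which gives the two monotonicity
   conditions. *)
apply: (interval_euler (a := fun d => cont (pre d s) a) (b := fun d => cont (suf d s) b)).
  by move=> d Hd; apply: cont_subseq; apply: pre_le Hs _ _.
by move=> d _; apply: cont_suf_le.
Qed.

Lemma distD X Y n c : dist (fun s => X s + Y s) n c = dist X n c + dist Y n c.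
Proof. by rewrite /dist -big_split; apply: eq_bigr => s _; rewrite mulnDl. Qed.

Lemma dist_bracket a b n c : all (leq 1) b ->
  dist (contn (bracket a b)) n c + dist (conv_step (contn a) (contn b)) n c =
  dist (conv (contn a) (contn b)) n c.
Proof.
by move=> Hb; rewrite -distD; apply: eq_dist => s Hs; apply: cont_bracket_euler Hs Hb.
Qed.

(** The [conv_step] terms of the two sides have the same distribution, so they cancel in
    [dist_bracket] and only convolutions are compared. *)
Lemma bracket_equid a a' b b' : all (leq 1) b -> all (leq 1) b' ->
  equid (contn a) (contn a') -> equid (contn b) (contn b') ->
  equid (contn (bracket a b)) (contn (bracket a' b')).
Proof.
move=> Hb Hb' Ha Hbb n c; apply: (@addIn (dist (conv_step (contn a) (contn b)) n c)).
rewrite dist_bracket // (conv_step_equid Ha Hbb) dist_bracket //.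
exact: conv_equid.
Qed.

Lemma bracketC_equid a b : all (leq 1) a -> all (leq 1) b ->
  equid (contn (bracket a b)) (contn (bracket b a)).
Proof.
move=> Ha Hb n c; apply: (@addIn (dist (conv_step (contn a) (contn b)) n c)).
by rewrite dist_bracket // conv_step_comm dist_bracket // conv_comm.
Qed.

Lemma nblocks_shift k b : b != [::] -> nblocks (map (addn k) b) = k + nblocks b.
Proof.
elim: b => // x [|y b] IH _; first by rewrite /= !maxn0.
rewrite -[LHS]/(maxn (k + x) (nblocks (map (addn k) (y :: b)))) IH //.
by rewrite -addn_maxr.
Qed.

Lemma nblocks_bracket a b : nblocks (bracket a b) = nblocks a + nblocks b.
Proof.
rewrite nblocks_cat; case: (eqVneq b [::]) => [->|Hb]; first by rewrite maxn0 addn0.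
by rewrite nblocks_shift //; apply/maxn_idPr; apply: leq_addr.
Qed.

Lemma bracketA a b c : bracket (bracket a b) c = bracket a (bracket b c).
Proof.
rewrite {1 3}/bracket nblocks_bracket -catA map_cat -map_comp; congr (_ ++ (_ ++ _)).
by apply: eq_map => x /=; rewrite addnA.
Qed.

Lemma bracketx0 a : bracket a [::] = a.
Proof. exact: cats0. Qed.

Lemma bracket0x a : bracket [::] a = a.
Proof. exact: map_id. Qed.

Lemma bracket_gt0 a b : all (leq 1) a -> all (leq 1) b -> all (leq 1) (bracket a b).
Proof.
move=> Ha Hb; rewrite all_cat Ha all_map; apply: sub_all Hb => x /= Hx.
exact: ltn_addl.
Qed.

Lemma bracket_all_gt0 ss : all (all (leq 1)) ss -> all (leq 1) (bracket_all ss).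
Proof. by elim: ss => //= s ss IH /andP[H /IH]; apply: bracket_gt0. Qed.

Lemma bracket_all_cat ss tt :
  bracket_all (ss ++ tt) = bracket (bracket_all ss) (bracket_all tt).
Proof. by elim: ss => [|s ss IH] /=; rewrite ?bracket0x // IH bracketA. Qed.

(** The head s sits in [tt] between [t1] and [t2]. Induction replaces the tail by [t1 ++ t2], and
    one use of commutativity carries s past all of [t1]. *)
Lemma perm_bracket_all ss tt : all (all (leq 1)) ss -> perm_eq ss tt ->
  equid (contn (bracket_all ss)) (contn (bracket_all tt)).
Proof.
elim: ss tt => [|s ss IH] tt Hss Hp.
  by have /perm_nilP-> : perm_eq tt [::] by rewrite perm_sym.
have Hs : s \in tt by rewrite -(perm_mem Hp) mem_head.
have Htt : all (all (leq 1)) tt by rewrite -(perm_all _ Hp).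
case/splitPr: Hs Hp Htt => t1 t2 Hp.
rewrite all_cat /= => /and3P[Ht1 Hts Ht2] n c.
have {}Hp : perm_eq ss (t1 ++ t2).
  by rewrite -(perm_cons s) (perm_trans Hp) // perm_catC /= perm_cons perm_catC.
case/andP: Hss => _ Hss; have {IH} := IH _ Hss Hp => IH.
have Gss := bracket_all_gt0 Hss.
have G1 := bracket_all_gt0 Ht1; have G2 := bracket_all_gt0 Ht2.
transitivity (dist (contn (bracket s (bracket_all (t1 ++ t2)))) n c).
  apply: bracket_equid => //; apply: bracket_all_gt0; by rewrite all_cat Ht1.
rewrite !bracket_all_cat /= -!bracketA.
apply: bracket_equid => //; exact: bracketC_equid.
Qed.

(** * The generated words are the noncrossing partitions *)

Lemma is_partition_rcons s x :
  is_partition (rcons s x) = is_partition s && (0 < x <= (nblocks s).+1).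
Proof.
suff H m : rgw_aux m (rcons s x) = rgw_aux m s && (0 < x <= (maxn m (nblocks s)).+1).
  by rewrite /is_partition H max0n.
elim: s m => [|y s IH] m /=; first by rewrite maxn0 andbT.
by rewrite IH -maxnA -!andbA.
Qed.

Lemma NC_partition n s : s \in NC n -> is_partition s.
Proof.
move: n s; apply: NC_ind => // n s x Hs IH.
rewrite is_partition_rcons IH mem_rcons inE => /orP[/eqP->|/opens_sub]; first by rewrite leqnn.
by rewrite (mem_NC_letter Hs) => /andP[-> H]; apply: leqW.
Qed.

Lemma partition_gt0 s : is_partition s -> all (leq 1) s.
Proof.
elim/last_ind: s => // s x IH; rewrite is_partition_rcons all_rcons.
by case/andP=> /IH -> /andP[-> _].
Qed.

Lemma NC_avoids n s : s \in NC n -> avoids s pat1212.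
Proof.
move=> Hs /containsP/contP[x Hx /order_isoP[]].
case: x Hx => [|a [|b [|c [|d [|]]]]] // Hx _ H.
have Hab : a < b by rewrite (H 0 1).
have E1 : a = c.
  by have := H 0 2 isT isT; have := H 2 0 isT isT => /=; case: ltngtP.
have E2 : b = d.
  by have := H 1 3 isT isT; have := H 3 1 isT isT => /=; case: ltngtP.
by have [/negP + _] := NC_no_crossing Hs Hab; apply; rewrite {2}E1 {2}E2.
Qed.

Lemma opens_blocked s x : x \in s -> x \notin opens s ->
  exists2 a, a < x & subseq [:: x; a] s.
Proof.
elim/last_ind: s => // s y IH; rewrite mem_rcons inE opens_rcons mem_rcons inE mem_filter negb_or.
case: eqP => //= Nxy Hx; rewrite negb_and -leqNgt => /orP[Hy|Hn].
  exists y; first by rewrite ltn_neqAle Hy andbT; apply/eqP => E; case: Nxy.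
  by rewrite (subseq_rcons2 [:: x]) eqxx sub1seq.
have [a Ha Hs] := IH Hx Hn; exists a => //; exact: subseq_trans Hs (subseq_rcons _ _).
Qed.

(** If the last letter x is neither new nor open, some a < x occurs after an earlier x; a also
    occurs before the first x, so a x a x appears. *)
Lemma noncrossing_NC s : noncrossing s -> s \in NC (size s).
Proof.
case; elim/last_ind: s => // s x IH; rewrite is_partition_rcons => /andP[Hp Hx] Hav.
have Hs : s \in NC (size s).
  apply: IH => // /containsP Hc; apply: Hav; apply/containsP.
  exact: cont_subseq (subseq_rcons _ _) Hc.
have Hm := mem_NC_letter Hs.
rewrite size_rcons mem_NC_rcons Hs mem_rcons inE /=.
case: eqP => //= Nx; apply/negPn/negP => Hn.
have Hxs : x \in s by rewrite Hm; lia.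
have [a Hax Hsub] := opens_blocked Hxs Hn.
have Ha0 : 0 < a.
  have : a \in s by apply: (mem_subseq Hsub); rewrite !inE eqxx orbT.
  by rewrite Hm => /andP[].
have x0 : 0 < x by exact: leq_trans Hax.
have Hpre c : (c \in take (index x s) s) = (0 < c < x).
  rewrite -{1}(prednK x0) -/(pre x.-1 s) (mem_NC_letter (pre_NC _ Hs)) (nblocks_pre Hs).
    by rewrite -(ltnS c) prednK.
  by rewrite Hm in Hxs; lia.
apply: Hav; apply/containsP/contP; exists [:: a; x; a; x].
  rewrite (subseq_rcons2 [:: a; x; a]) eqxx -(cat_take_drop (index x s) s).
  apply: (@cat_subseq _ [:: a] [:: x; a]); first by rewrite sub1seq Hpre Ha0.
  move: Hsub; rewrite -{1}(cat_take_drop (index x s) s).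
  have: x \notin take (index x s) s by rewrite Hpre ltnn andbF.
  elim: (take _ _) => //= y u IHu.
  rewrite inE negb_or => /andP[/negbTE Hxy Hu].
  by rewrite Hxy; apply: IHu.
apply/order_isoP; split=> // -[|[|[|[|i]]]] [|[|[|[|j]]]] //= _ _; rewrite ?ltnn ?Hax //;
  by rewrite ltnNge ltnW.
Qed.

(** * Open letters count components *)

Lemma bracket_rcons a b x : bracket a (rcons b x) = rcons (bracket a b) (nblocks a + x).
Proof. by rewrite /bracket map_rcons -rcons_cat. Qed.

Lemma opens_bracket a b : all (leq 1) b ->
  opens (bracket a b) = opens a ++ map (addn (nblocks a)) (opens b).
Proof.
elim/last_ind: b => [|b x IH]; first by rewrite bracketx0 cats0.
rewrite all_rcons => /andP[Hx /IH{}IH].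
rewrite bracket_rcons !opens_rcons IH filter_cat map_rcons -rcons_cat; congr (rcons (_ ++ _) _).
  rewrite (@eq_in_filter _ _ predT) ?filter_predT // => y /opens_sub/nblocks_ge Hy.
  by rewrite (leq_ltn_trans Hy) // -addn1 leq_add2l.
by rewrite filter_map; congr map; apply: eq_filter => y /=; rewrite ltn_add2l.
Qed.

Lemma ncomp_bracket a b : all (leq 1) b -> ncomp (bracket a b) = ncomp a + ncomp b.
Proof. by move=> Hb; rewrite /ncomp opens_bracket // size_cat size_map. Qed.

Lemma NC_bracket a b : a \in NC (size a) -> b \in NC (size b) ->
  bracket a b \in NC (size a + size b).
Proof.
move=> Ha; elim/last_ind: b => [|b x IH]; first by rewrite bracketx0 addn0.
rewrite size_rcons mem_NC_rcons => /andP[Hb Hx].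
rewrite addnS bracket_rcons mem_NC_rcons IH //=.
rewrite /next opens_bracket ?(NC_letter_gt0 Hb) // nblocks_bracket -addnS.
move: Hx; rewrite !mem_rcons !inE => /orP[/eqP->|Hx]; first by rewrite eqxx.
by rewrite mem_cat (map_f (addn _)) ?orbT.
Qed.

Lemma suf_bracket a b : all (leq 1) b -> suf (nblocks a) (bracket a b) = b.
Proof.
move=> /allP Hb; rewrite /suf /bracket filter_cat (@eq_in_filter _ _ pred0); last first.
  by move=> y /nblocks_ge; rewrite leqNgt => /negbTE.
rewrite filter_pred0 filter_map -map_comp (@eq_in_filter _ _ predT) ?filter_predT; last first.
  by move=> y /Hb /= Hy; rewrite -addn1 leq_add2l.
by rewrite -[RHS]map_id; apply: eq_map => y /=; rewrite addKn.
Qed.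

Lemma bracket_NC n a b : all (leq 1) b -> bracket a b \in NC n ->
  a \in NC (size a) /\ b \in NC (size b).
Proof.
move=> Hb H; split; first exact: NC_cat H.
by have := suf_NC (nblocks a) H; rewrite suf_bracket.
Qed.

(** A smaller letter after the first x would close x for good. Thus the first occurrence of an open
    letter starts a component. *)
Lemma opens_tail n s x : s \in NC n -> x \in opens s ->
  all (leq x) (drop (index x s) s).
Proof.
move=> Hs; move: n s Hs x; apply: NC_ind => // n s y Hs IH Hy x.
have aux z : z \in opens s -> z <= y -> all (leq z) (drop (index z (rcons s y)) (rcons s y)).
  move=> Hz Hzy; rewrite -cats1 index_cat (opens_sub Hz) drop_cat index_mem (opens_sub Hz).
  by rewrite all_cat IH //= Hzy.
rewrite opens_rcons mem_rcons inE mem_filter => /orP[/eqP->|/andP[Hx Hxo]]; last first.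
  by apply: aux => //; apply: ltnW.
move: Hy; rewrite mem_rcons inE => /orP[/eqP E|Hyo]; last by apply: aux.
have Hn : y \notin s by rewrite (mem_NC_letter Hs) E ltnn andbF.
by rewrite -cats1 index_cat (negbTE Hn) /= eqxx addn0 drop_size_cat //= leqnn.
Qed.

Lemma bracket_pre_suf n s d : s \in NC n -> d.+1 \in opens s ->
  s = bracket (pre d s) (suf d s).
Proof.
move=> Hs Hd; have Hdn : d < nblocks s by apply: nblocks_ge; apply: opens_sub.
rewrite /bracket (nblocks_pre Hs (ltnW Hdn)) -[LHS](cat_take_drop (index d.+1 s) s).
congr (_ ++ _).
have -> : suf d s = map (subn^~ d) (drop (index d.+1 s) s).
  rewrite /suf; congr map.
  have -> : [seq x <- s | d < x] = [seq x <- pre d s | d < x] ++ [seq x <- drop (index d.+1 s) s | d < x].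
    by rewrite -filter_cat cat_take_drop.
  rewrite (@eq_in_filter _ _ pred0) ?filter_pred0 /=; last first.
    by move=> y /nblocks_ge; rewrite (nblocks_pre Hs (ltnW Hdn)) leqNgt => /negbTE.
  by apply/all_filterP; apply: opens_tail Hs Hd.
rewrite -map_comp -[LHS]map_id; apply/eq_in_map => y.
by move/(allP (opens_tail Hs Hd)) => Hy /=; rewrite subnKC // ltnW.
Qed.

Lemma ncomp_eq0 s : (ncomp s == 0) = (s == [::]).
Proof. by case/lastP: s => // s x; rewrite /ncomp opens_rcons size_rcons -size_eq0 size_rcons. Qed.

Lemma NC_split n s : s \in NC n -> 1 < ncomp s ->
  exists a b, [/\ a \in NC (size a), b \in NC (size b), a <> [::], b <> [::] & s = bracket a b].
Proof.
move=> Hs; have := sorted_opens s; rewrite /ncomp.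
case E: (opens s) => [|x1 [|x2 l]] //= /andP[Hx12 _] _.
(* The word is cut before the first [x2], which becomes d + 1; as 1 [<=] [x1] [<=] d, the left
   factor is nonempty too. *)
have Ho : x2 \in opens s by rewrite E !inE eqxx orbT.
case: x2 E Hx12 Ho => // d E Hx1 Ho.
have H1 : 0 < x1.
  have : x1 \in s by apply: opens_sub; rewrite E mem_head.
  by rewrite (mem_NC_letter Hs) => /andP[].
have Hdn : d < nblocks s by apply: nblocks_ge; apply: opens_sub.
exists (pre d s), (suf d s); split.
- exact: pre_NC Hs.
- exact: suf_NC Hs.
- move=> H; have := nblocks_pre Hs (ltnW Hdn); rewrite H /=; lia.
- move=> H; have := nblocks_suf d s; rewrite H /=; lia.
- exact: bracket_pre_suf Hs Ho.
Qed.

Lemma connected_ncomp n s : s \in NC n -> connected s <-> ncomp s = 1.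
Proof.
move=> Hs; split.
  case=> _ [Hn Hc]; have [H|H|//] := ltngtP (ncomp s) 1.
    by move: H; rewrite ltnS leqn0 ncomp_eq0 => /eqP.
  have [a [b [Ha Hb Na Nb E]]] := NC_split Hs H.
  by case: Hc; exists a, b; split=> //; apply: NC_partition; eassumption.
move=> H1; split; first exact: NC_partition Hs.
split=> [E|]; first by rewrite E in H1.
case=> a [b [Ha Hb /eqP Na /eqP Nb E]].
move: H1; rewrite E ncomp_bracket ?partition_gt0 //.
by rewrite -ncomp_eq0 -lt0n in Na; rewrite -ncomp_eq0 -lt0n in Nb; lia.
Qed.

(** [ncomp] is additive over [bracket] and equals 1 exactly on connected words; existence follows by
    splitting until all factors are connected. *)
Lemma has_ncompP n s m : s \in NC n -> has_ncomp s m <-> m = ncomp s.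
Proof.
move=> Hs; split.
  case=> ss [<- Hss E]; rewrite E in Hs *.
  elim: ss n {E} Hss Hs => //= t ss IH n Hss Hs.
  have Hgt : all (leq 1) (bracket_all ss).
    apply: bracket_all_gt0; apply/allP => u Hu; apply: partition_gt0.
    by case: (Hss u) => //; rewrite inE Hu orbT.
  have [Ht Hr] := bracket_NC Hgt Hs.
  rewrite ncomp_bracket //; have /(connected_ncomp Ht)-> := Hss t (mem_head _ _).
  rewrite -(IH _ _ Hr) // => u Hu; apply: Hss; by rewrite inE Hu orbT.
move=> ->; have [k Hk] := ubnP (size s); elim: k s n Hs Hk => // k IH s n Hs Hk.
case: (eqVneq s [::]) => [->|Hn]; first by exists [::].
have [H|H|H] := ltngtP (ncomp s) 1.
- by move: H; rewrite ltnS leqn0 ncomp_eq0 (negbTE Hn).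
- have [a [b [Ha Hb /eqP Na /eqP Nb E]]] := NC_split Hs H.
  have Hsz : size s = size a + size b by rewrite E size_cat size_map.
  rewrite -size_eq0 -lt0n in Na; rewrite -size_eq0 -lt0n in Nb.
  have [|sa [Sa Ca Ea]] := IH a _ Ha; first by lia.
  have [|sb [Sb Cb Eb]] := IH b _ Hb; first by lia.
  exists (sa ++ sb); split.
  + by rewrite size_cat Sa Sb E ncomp_bracket // (NC_letter_gt0 Hb).
  + by move=> u; rewrite mem_cat => /orP[/Ca|/Cb].
  + by rewrite bracket_all_cat -Ea -Eb.
- exists [:: s]; split; rewrite ?H //=; last by rewrite bracketx0.
  by move=> u; rewrite inE => /eqP->; apply/(connected_ncomp Hs).
Qed.

(** * From equidistribution to a bijection *)

Definition avoiders (p : seq nat) (n c : nat) : seq (seq nat) :=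
  [seq s <- NC n | (ncomp s == c) && ~~ cont s p].

(** The total does not depend on p, so equidistributed patterns have equally many avoiders in each
    class. *)
Lemma size_avoiders p n c :
  size (avoiders p n c) + dist (contn p) n c = \sum_(s <- NC n) (ncomp s == c).
Proof.
rewrite size_filter -sum1_count big_mkcond /dist -big_split /=.
by apply: eq_bigr => s _; rewrite /contn; case: eqP; case: cont.
Qed.

Lemma uniq_avoiders p n c : uniq (avoiders p n c).
Proof. by rewrite filter_uniq // uniq_NC. Qed.

Lemma AvP p s : Av p s <-> s \in avoiders p (size s) (ncomp s).
Proof.
rewrite mem_filter eqxx /=; split.
  case=> H1 H2 H3; rewrite noncrossing_NC // andbT.
  by apply/negP => /containsP.
by case/andP=> /negP H Hs; split; [exact: NC_partition Hs|exact: NC_avoids Hs|move/containsP].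
Qed.

(** Pairs the avoiders of p and of q that have the same position in their lists, within each class
    of given length and number of components. *)
Definition transfer (p q s : seq nat) : seq nat :=
  nth [::] (avoiders q (size s) (ncomp s)) (index s (avoiders p (size s) (ncomp s))).

Lemma transferP p q s : equid (contn p) (contn q) -> Av p s ->
  [/\ Av q (transfer p q s), transfer q p (transfer p q s) = s,
      size (transfer p q s) = size s & ncomp (transfer p q s) = ncomp s].
Proof.
move=> Hpq /AvP Hs.
have Hsz : size (avoiders p (size s) (ncomp s)) = size (avoiders q (size s) (ncomp s)).
  by apply: (@addIn (dist (contn p) (size s) (ncomp s))); rewrite size_avoiders Hpq size_avoiders.
set t := transfer p q s.
have Hi : index s (avoiders p (size s) (ncomp s)) < size (avoiders q (size s) (ncomp s)).
  by rewrite -Hsz index_mem.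
have Ht : t \in avoiders q (size s) (ncomp s) by apply: mem_nth.
have [Et1 Et2] : size t = size s /\ ncomp t = ncomp s.
  by move: Ht; rewrite mem_filter => /andP[/andP[/eqP-> _] /size_NC->].
split=> //; first by apply/AvP; rewrite Et1 Et2.
by rewrite {1}/transfer Et1 Et2 /t /transfer index_uniq ?uniq_avoiders // nth_index.
Qed.

Lemma equid_cc_equiv p q : noncrossing p -> noncrossing q ->
  equid (contn p) (contn q) -> cc_equiv p q.
Proof.
move=> Hp Hq Hpq; have Hqp : equid (contn q) (contn p) by move=> n c; rewrite Hpq.
split=> //; exists (transfer p q), (transfer q p); split=> s Hs; last first.
  by have [H1 H2 _ _] := transferP Hqp Hs.
have [H1 H2 H3 H4] := transferP Hpq Hs; split=> // m.
move/AvP: Hs; rewrite mem_filter => /andP[_ Hs].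
move/AvP: H1; rewrite mem_filter => /andP[_ H1].
by rewrite (has_ncompP _ Hs) (has_ncompP _ H1) H4.
Qed.

Lemma noncrossing_bracket_all ss :
  (forall s, s \in ss -> noncrossing s) -> noncrossing (bracket_all ss).
Proof.
move=> H; suff Hs : bracket_all ss \in NC (size (bracket_all ss)).
  by split; [exact: NC_partition Hs|exact: NC_avoids Hs].
elim: ss H => //= s ss IH H.
have Hs : s \in NC (size s) by apply: noncrossing_NC; apply: H; rewrite mem_head.
have -> : size (bracket s (bracket_all ss)) = size s + size (bracket_all ss).
  by rewrite size_cat size_map.
by apply: NC_bracket => //; apply: IH => u Hu; apply: H; rewrite inE Hu orbT.
Qed.

Theorem theorem3p4 (k : nat) (sigma : 'I_k -> seq nat) (p : {perm 'I_k}) :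
  (forall i, noncrossing (sigma i)) ->
  cc_equiv (bracket_all [seq sigma i | i <- enum 'I_k])
           (bracket_all [seq sigma (p i) | i <- enum 'I_k]).
Proof.
move=> Hsigma; apply: equid_cc_equiv.
- by apply: noncrossing_bracket_all => s /mapP[i _ ->].
- by apply: noncrossing_bracket_all => s /mapP[i _ ->].
apply: perm_bracket_all.
  by apply/allP => s /mapP[i _ ->]; apply: partition_gt0; case: (Hsigma i).
(* Both lists are images under [sigma] of enumerations of ['I_k], the second one rearranged by p. *)
rewrite (map_comp sigma p); apply: perm_map; apply: uniq_perm; rewrite ?enum_uniq //.
  by rewrite map_inj_uniq ?enum_uniq //; apply: perm_inj.
move=> i; rewrite mem_enum; symmetry; apply/mapP; exists (p^-1%g i); rewrite ?mem_enum //.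
by rewrite permKV.
Qed.
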